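(* Let $F$ be a nontrivial finite group, let $\tfrac12<p<1$, and let $R_n$ be the stationary random walk on $F\wr\mathbb{Z}$ with parameter $p$. Let $\alpha=\frac{\log|F|}{\log\frac{p}{1-p}}$ and let $\xi(\mathrm{id},n)=|\{0\le k\le n: R_k=\mathrm{id}\}|$, where $\mathrm{id}$ is the identity of $F\wr\mathbb{Z}$. Then there exist constants $0<c\le C<\infty$ depending only on $p$ and $|F|$ such that for all $n\ge 2$, $c\,f(n)\le \mathbb{E}[\xi(\mathrm{id},n)]\le C\,f(n)$, where $f(n)=1$ if $p<\frac{|F|^2}{|F|^2+1}$, $f(n)=\log n$ if $p=\frac{|F|^2}{|F|^2+1}$, and $f(n)=n^{1-2\alpha}$ if $p>\frac{|F|^2}{|F|^2+1}$.
   Context: Elements of $F\wr\mathbb{Z}$ are pairs $((L(i))_{i\in\mathbb{Z}},x)$ with $L:\mathbb{Z}\to F$ finitely supported and $x\in\mathbb{Z}$; the identity has all lamps $\mathrm{id}_F$ and $x=0$. The stationary random walk with parameter $p$: let $(S_n)_{n\ge0}$ be the Markov chain on $\mathbb{Z}$ with $S_0=0$ and $\Pr(S_{n+1}=x+1\mid S_n=x)$ equal to $p$ if $x<0$, $\tfrac12$ if $x=0$, $1-p$ if $x>0$, and $\Pr(S_{n+1}=x-1\mid S_n=x)$ equal to $1-p$ if $x<0$, $\tfrac12$ if $x=0$, $p$ if $x>0$. Let $(U_n,V_n)_{n\ge1}$ be i.i.d. pairs of independent uniform elements of $F$, independent of $(S_n)$. Set $L_0\equiv\mathrm{id}_F$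 and $R_n=((L_n(i))_i,S_n)$ where $L_{n+1}(i)=L_n(i)$ for $i\notin\{S_n,S_{n+1}\}$, $L_{n+1}(S_n)=U_{n+1}$, $L_{n+1}(S_{n+1})=V_{n+1}$. *)

(* Defs.v *)
From HB Require Import structures.
From mathcomp Require Import all_boot all_order all_algebra all_fingroup.
From mathcomp Require Import all_classical all_reals all_analysis.
Set Implicit Arguments. Unset Strict Implicit. Unset Printing Implicit Defensive.
Import Order.TTheory GRing.Theory Num.Theory.
Local Open Scope ring_scope.

(* A trajectory of the base walk S is encoded by its sequence of steps
   b : seq bool (true = +1, false = -1); S_0 = 0. *)
Fixpoint walk_pos (b : seq bool) (j : nat) : int :=
  match j with
  | 0 => 0
  | j'.+1 => walk_pos b j' + (if nth false b j' then 1 else -1)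
  end.

Definition step_prob (R : realType) (p : R) (x : int) (up : bool) : R :=
  if x < 0 then (if up then p else 1 - p)
  else if x == 0 then 1 / 2
  else (if up then 1 - p else p).

Definition path_prob (R : realType) (p : R) (b : seq bool) : R :=
  \prod_(j < size b) step_prob p (walk_pos b j) (nth false b j).

(* lamp configuration L_j given the steps b and U_{i+1} = nth u i,
   V_{i+1} = nth v i *)
Fixpoint lamps (F : finGroupType) (b : seq bool) (u v : seq F) (j : nat)
  : int -> F :=
  match j with
  | 0 => fun _ => 1%g
  | j'.+1 => fun i =>
      if i == walk_pos b j'.+1 then nth 1%g v j'
      else if i == walk_pos b j' then nth 1%g u j'
      else lamps b u v j' i
  end.

Definition is_identity (F : finGroupType) (b : seq bool) (u v : seq F) (j : nat)
  : Prop :=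
  walk_pos b j = 0 /\ forall i : int, lamps b u v j i = 1%g.

(* the sample space up to time n: steps of S, (U_1..U_n), (V_1..V_n) *)
Definition omega (F : finGroupType) (n : nat) : finType :=
  (n.-tuple bool * n.-tuple F * n.-tuple F)%type.

Definition xi_id (F : finGroupType) (n : nat) (w : omega F n) : nat :=
  #|[set k : 'I_n.+1 | `[< is_identity w.1.1 w.1.2 w.2 k >]]|.

(* probability of an outcome: Markov path law times independent uniform lamps *)
Definition omega_prob (R : realType) (p : R) (F : finGroupType) (n : nat)
  (w : omega F n) : R :=
  path_prob p w.1.1 * (#|F|%:R ^+ (2 * n))^-1.

Definition expected_visits (R : realType) (p : R) (F : finGroupType) (n : nat) : R :=
  \sum_(w : omega F n) omega_prob p w * (xi_id w)%:R.

Definition alpha (R : realType) (p : R) (m : nat) : R :=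
  ln (m%:R) / ln (p / (1 - p)).

Definition growth (R : realType) (p : R) (m : nat) (n : nat) : R :=
  let thr := (m%:R ^+ 2) / (m%:R ^+ 2 + 1) in
  if p < thr then 1
  else if p == thr then ln (n%:R)
  else powR (n%:R) (1 - 2 * alpha p m).

(* Main.v *)
(** Given the path of S up to time k, the lamps on the visited sites are
independent and uniform, so E[xi] is the sum over k <= n of
E[1(S_k = 0) |F|^(-r_k)], where r_k is the number of visited sites. If the walk
ranges over [-A, B], then r_k = A + B + 1 lies between 2 min(A, B) and
2 max(A, B) + 1; summing |F|^(-2c) over c replaces |F|^(-r_k), up to constants,
by indicators that the walk stays in [-c, c], resp. below c or above -c. This
leaves the expected number of visits to 0 before time n of the walk killed
outside such a window, which is of order rho^c with rho = p / (1 - p) as long as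
rho^c <= n, and is at most n otherwise; both bounds come from explicit
super- and subharmonic functions. Hence E[xi] is comparable to the geometric sum
of (rho / |F|^2)^c over c <= log_rho n, and the three regimes are
rho / |F|^2 < 1, = 1 and > 1. *)
Require Import Defs.
From HB Require Import structures.
From mathcomp Require Import all_boot all_order all_algebra all_fingroup.
From mathcomp Require Import all_classical all_reals all_analysis.
From mathcomp Require Import ring lra zify.
Import Order.TTheory GRing.Theory Num.Theory.
Local Open Scope ring_scope.

(** * Expectations over paths and lamps, one time step at a time *)

Lemma big_tuple_rcons {V : nmodType} (T : finType) (k : nat) (f : seq T -> V) :
  \sum_(t : k.+1.-tuple T) f t =
  \sum_(t : k.-tuple T) \sum_(x : T) f (rcons t x).
Proof.
rewrite pair_big /=.
pose h (q : k.-tuple T * T) : k.+1.-tuple T := [tuple of rcons q.1 q.2].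
rewrite (reindex h) //=; apply/onW_bij/inj_card_bij.
  move=> [t x] [t' x'] /(congr1 val) /= /rcons_inj [e ->].
  by congr pair; exact: val_inj.
by rewrite card_prod !card_tuple expnSr.
Qed.

Definition path_sum {R : realType} (p : R) (k : nat) (f : seq bool -> R) : R :=
  \sum_(t : k.-tuple bool) path_prob p t * f t.

Definition lamp_avg {R : realType} (F : finGroupType) (k : nat)
    (f : seq F -> seq F -> R) : R :=
  (#|F|%:R ^+ (2 * k))^-1 *
  \sum_(u : k.-tuple F) \sum_(v : k.-tuple F) f u v.

Lemma walk_pos_rcons (b : seq bool) (c : bool) (j : nat) :
  (j <= size b)%N -> walk_pos (rcons b c) j = walk_pos b j.
Proof.
by elim: j => //= j IH jb; rewrite IH ?(ltnW jb) // nth_rcons jb.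
Qed.

Lemma walk_pos_rconsS (b : seq bool) (c : bool) (k : nat) : size b = k ->
  walk_pos (rcons b c) k.+1 = walk_pos b k + (if c then 1 else -1).
Proof.
by move=> <- /=; rewrite walk_pos_rcons // nth_rcons ltnn eqxx.
Qed.

Lemma step_prob_sum {R : realType} (p : R) (x : int) :
  step_prob p x true + step_prob p x false = 1.
Proof.
by rewrite /step_prob; case: ifP => _; [|case: ifP => _]; lra.
Qed.

Lemma step_prob_ge0 {R : realType} (p : R) (x : int) (c : bool) :
  0 <= p <= 1 -> 0 <= step_prob p x c.
Proof.
by rewrite /step_prob; case: ifP => _; [|case: ifP => _]; case: c; lra.
Qed.

Lemma path_prob_ge0 {R : realType} (p : R) (b : seq bool) :
  0 <= p <= 1 -> 0 <= path_prob p b.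
Proof. by move=> p01; apply: prodr_ge0 => i _; exact: step_prob_ge0. Qed.

Lemma path_prob_rcons {R : realType} (p : R) (b : seq bool) (c : bool) :
  path_prob p (rcons b c) = path_prob p b * step_prob p (walk_pos b (size b)) c.
Proof.
rewrite /path_prob size_rcons big_ord_recr /= nth_rcons ltnn eqxx.
rewrite walk_pos_rcons //; congr (_ * _); apply: eq_bigr => i _.
by rewrite walk_pos_rcons ?nth_rcons ?ltn_ord // ltnW.
Qed.

Lemma eq_path_sum {R : realType} (p : R) (k : nat) (f g : seq bool -> R) :
  (forall b, size b = k -> f b = g b) -> path_sum p k f = path_sum p k g.
Proof.
by move=> fg; apply: eq_bigr => t _; rewrite fg ?size_tuple.
Qed.

Lemma ler_path_sum {R : realType} (p : R) (k : nat) (f g : seq bool -> R) :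
  0 <= p <= 1 -> (forall b, size b = k -> f b <= g b) ->
  path_sum p k f <= path_sum p k g.
Proof.
move=> p01 fg; apply: ler_sum => t _.
by apply: ler_wpM2l; [exact: path_prob_ge0|rewrite fg ?size_tuple].
Qed.

Lemma path_sumD {R : realType} (p : R) (k : nat) (f g : seq bool -> R) :
  path_sum p k (fun b => f b + g b) = path_sum p k f + path_sum p k g.
Proof. by rewrite -big_split; apply: eq_bigr => t _; rewrite mulrDr. Qed.

Lemma path_sumZ {R : realType} (p : R) (k : nat) (a : R) (f : seq bool -> R) :
  path_sum p k (fun b => a * f b) = a * path_sum p k f.
Proof. by rewrite mulr_sumr; apply: eq_bigr => t _; rewrite mulrCA. Qed.

Lemma path_sum_sum {R : realType} (p : R) (k N : nat)
    (f : nat -> seq bool -> R) :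
  path_sum p k (fun b => \sum_(c < N) f c b) = \sum_(c < N) path_sum p k (f c).
Proof.
by rewrite exchange_big; apply: eq_bigr => t _; rewrite mulr_sumr.
Qed.

(** Markov property at the last step: appending at the end leaves earlier positions unchanged, so
    the new transition only sees [walk_pos b k]. *)
Lemma path_sum_recr {R : realType} (p : R) (k : nat) (f : seq bool -> R) :
  path_sum p k.+1 f = path_sum p k (fun b =>
    step_prob p (walk_pos b k) true * f (rcons b true) +
    step_prob p (walk_pos b k) false * f (rcons b false)).
Proof.
rewrite /path_sum (big_tuple_rcons bool k (fun b => path_prob p b * f b)).
apply: eq_bigr => t _; rewrite big_bool !path_prob_rcons size_tuple.
by rewrite mulrDr !mulrA.
Qed.

Lemma path_sum0 {R : realType} (p : R) (f : seq bool -> R) :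
  path_sum p 0 f = f [::].
Proof.
rewrite /path_sum (big_pred1 [tuple]) => [|t]; last first.
  by rewrite /= (tuple0 t); apply/esym/eqP.
by rewrite /path_prob big_ord0 mul1r.
Qed.

Lemma path_sum1 {R : realType} (p : R) (k : nat) :
  path_sum p k (fun=> 1) = 1.
Proof.
elim: k => [|k IH]; first exact: path_sum0.
rewrite path_sum_recr -[RHS]IH; apply: eq_path_sum => b _.
by rewrite !mulr1 step_prob_sum.
Qed.

Lemma eq_lamp_avg {R : realType} (F : finGroupType) (k : nat)
    (f g : seq F -> seq F -> R) :
  (forall u v, size u = k -> size v = k -> f u v = g u v) ->
  lamp_avg F k f = lamp_avg F k g.
Proof.
move=> fg; congr (_ * _); apply: eq_bigr => u _; apply: eq_bigr => v _.
by rewrite fg ?size_tuple.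
Qed.

Lemma lamp_avgZ {R : realType} (F : finGroupType) (k : nat) (a : R)
    (f : seq F -> seq F -> R) :
  lamp_avg F k (fun u v => a * f u v) = a * lamp_avg F k f.
Proof.
rewrite /lamp_avg mulrCA; congr (_ * _); rewrite mulr_sumr.
by apply: eq_bigr => u _; rewrite mulr_sumr.
Qed.

Lemma lamp_avg_recr {R : realType} (F : finGroupType) (k : nat)
    (f : seq F -> seq F -> R) :
  lamp_avg F k.+1 f = lamp_avg F k (fun u v =>
    (#|F|%:R ^+ 2)^-1 * \sum_(x : F) \sum_(y : F) f (rcons u x) (rcons v y)).
Proof.
rewrite lamp_avgZ /lamp_avg mulrA -invfM mulnS exprD; congr (_ * _).
rewrite (big_tuple_rcons F k (fun u => \sum_(v : k.+1.-tuple F) f u v)).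
apply: eq_bigr => u _; rewrite [RHS]exchange_big; apply: eq_bigr => x _.
by rewrite (big_tuple_rcons F k (fun v => f (rcons u x) v)).
Qed.

(** * Reduction of a visit at time [k] to the first [k] steps *)

Lemma lamps_rcons (F : finGroupType) (b : seq bool) (u v : seq F) (x y : F)
    (j : nat) (i : int) : (j <= size u)%N -> (j <= size v)%N ->
  lamps b (rcons u x) (rcons v y) j i = lamps b u v j i.
Proof.
elim: j => //= j IH ju jv; rewrite IH ?(ltnW ju) ?(ltnW jv) //.
by rewrite !nth_rcons ju jv.
Qed.

Lemma lamps_rcons_path (F : finGroupType) (b : seq bool) (c : bool)
    (u v : seq F) (j : nat) (i : int) : (j <= size b)%N ->
  lamps (rcons b c) u v j i = lamps b u v j i.
Proof.
elim: j => //= j IH jb; rewrite IH ?(ltnW jb) //.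
by rewrite walk_pos_rcons ?(ltnW jb) // nth_rcons jb.
Qed.

Lemma is_identity_rcons (F : finGroupType) (b : seq bool) (u v : seq F)
    (c : bool) (x y : F) (j : nat) :
  (j <= size b)%N -> (j <= size u)%N -> (j <= size v)%N ->
  is_identity (rcons b c) (rcons u x) (rcons v y) j <-> is_identity b u v j.
Proof.
move=> jb ju jv; rewrite /is_identity walk_pos_rcons //.
by split=> -[-> h]; split=> // i; have := h i;
  rewrite lamps_rcons_path // lamps_rcons.
Qed.

Lemma sum_omega {R : realType} (p : R) (F : finGroupType) (n : nat)
    (f : seq bool -> seq F -> seq F -> R) :
  \sum_(w : omega F n) omega_prob p w * f w.1.1 w.1.2 w.2 =
  path_sum p n (fun b => lamp_avg F n (f b)).
Proof.
rewrite /lamp_avg /path_sum /omega_prob.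
under [RHS]eq_bigr => t _.
  rewrite mulrA mulr_sumr.
  under eq_bigr => u _ do rewrite mulr_sumr.
  over.
rewrite pair_big pair_big /=.
by apply: eq_bigr => -[[b u] v].
Qed.

(** Later coordinates do not affect the state at time [k], so they sum out one time step at a time:
    the two lamp sums cancel [#|F|%:R ^+ 2] and the two step probabilities add up to 1. *)
Lemma visit_prob_le {R : realType} (p : R) (F : finGroupType) (k n : nat) :
  (k <= n)%N ->
  path_sum p n (fun b => lamp_avg F n (fun u v => `[< is_identity b u v k >]%:R))
  = path_sum p k
      (fun b => lamp_avg F k (fun u v => `[< is_identity b u v k >]%:R)) :> R.
Proof.
have F0 : (#|F|%:R : R) != 0.
  by rewrite pnatr_eq0 -lt0n; apply/card_gt0P; exists 1%g.
move/subnK <-; elim: (n - k)%N => // d <-; rewrite addSn; set l := (d + k)%N.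
have kl : (k <= l)%N by rewrite leq_addl.
rewrite path_sum_recr; apply: eq_path_sum => b sb.
have key c : lamp_avg F l.+1
    (fun u v => `[< is_identity (rcons b c) u v k >]%:R) =
    lamp_avg F l (fun u v => `[< is_identity b u v k >]%:R) :> R.
  rewrite lamp_avg_recr; apply: eq_lamp_avg => u v su sv.
  under eq_bigr => x _.
    under eq_bigr => y _.
      rewrite (asbool_equiv_eq (is_identity_rcons F b u v c x y k _ _ _))
        ?sb ?su ?sv //.
      over.
    over.
  rewrite !sumr_const -mulrnA -[_ *+ (_ * _)]mulr_natl natrM.
  by rewrite -expr2 mulrA mulVf ?mul1r // expf_neq0.
by rewrite !key -mulrDl step_prob_sum mul1r.
Qed.

Lemma expected_visitsE {R : realType} (p : R) (F : finGroupType) (n : nat) :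
  expected_visits p F n = \sum_(k < n.+1) path_sum p k
    (fun b => lamp_avg F k (fun u v => `[< is_identity b u v k >]%:R)).
Proof.
rewrite /expected_visits /xi_id.
under eq_bigr => w _.
  rewrite -sum1_card natr_sum big_mkcond mulr_sumr.
  over.
rewrite exchange_big /=; apply: eq_bigr => k _.
have kn : (k <= n)%N by rewrite -ltnS.
transitivity (\sum_(w : omega F n)
    omega_prob p w * `[< is_identity w.1.1 w.1.2 w.2 k >]%:R).
  by apply: eq_bigr => w _; rewrite inE; case: `[< _ >].
by rewrite (sum_omega p F n (fun b u v => `[< is_identity b u v k >]%:R))
  visit_prob_le.
Qed.

(** * Law of the lamps given the path *)

(** Sites in the order of their refreshes, latest first. The list is empty at time 0, when no lamp
    has been randomized yet, not even the one at the origin. *)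
Fixpoint sites (b : seq bool) (k : nat) : seq int :=
  match k with
  | 0 => [::]
  | j.+1 => walk_pos b j.+1 :: walk_pos b j :: sites b j
  end.

(** Repetitions of the head in the tail are dropped, just as the latest refresh of a lamp overwrites
    the earlier ones. *)
Lemma size_undup_filter_cons (T : eqType) (E : pred T) (x : T) (l : seq T) :
  size (undup [seq y <- x :: l | E y]) =
  (E x + size (undup [seq y <- l | E y && (y != x)]))%N.
Proof.
have -> : [seq y <- l | E y && (y != x)] =
    [seq y <- [seq y <- l | E y] | y != x].
  by rewrite -filter_predI; apply: eq_filter => y /=; rewrite andbC.
rewrite /=; case Ex: (E x) => /=; last first.
  congr (size (undup _)); rewrite -filter_predI; apply: eq_filter => y /=.
  by case: eqVneq => [->|].
set l' := [seq y <- l | E y].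
rewrite -[RHS]/(size (x :: undup [seq y <- l' | y != x])).
apply/perm_size/uniq_perm.
- exact: (undup_uniq (x :: l')).
- by rewrite cons_uniq undup_uniq mem_undup mem_filter eqxx.
move=> z; rewrite (mem_undup (x :: l')) !inE mem_undup mem_filter.
by case: eqVneq.
Qed.

Lemma sum_implied {R : realType} (F : finGroupType) (e : bool) :
  \sum_(x : F) ((e ==> (x == 1%g))%:R : R) / #|F|%:R = (#|F|%:R ^+ e)^-1.
Proof.
have F0 : (#|F|%:R : R) != 0.
  by rewrite pnatr_eq0 -lt0n; apply/card_gt0P; exists 1%g.
rewrite -mulr_suml; case: e => /=.
  rewrite (bigD1 1%g) //= eqxx big1 ?addr0 ?mul1r ?expr1 // => x.
  by move=> /negPf ->.
by rewrite sumr_const mulr1n -[_ *+ _]mulr_natl mulr1 mulfV // invr1.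
Qed.

Lemma walk_posS_neq (b : seq bool) (k : nat) : walk_pos b k != walk_pos b k.+1.
Proof. by rewrite /=; apply/eqP; case: (nth _ _ _); lia. Qed.

(* The predicate [E] makes the induction on [k] possible: the last step
   overwrites the lamps at its two end points, and the earlier steps only
   matter for the other sites. *)
Lemma lamp_avg_off {R : realType} (F : finGroupType) (b : seq bool) (k : nat)
    (E : pred int) :
  lamp_avg F k (fun u v => `[< forall i, E i -> lamps b u v k i = 1%g >]%:R) =
  (#|F|%:R ^+ size (undup [seq i <- sites b k | E i]))^-1 :> R.
Proof.
elim: k E => [|k IH] E.
  rewrite /lamp_avg muln0 expr0 invr1 mul1r.
  rewrite (eq_bigr (fun=> 1)); last first.
    move=> u _; rewrite (eq_bigr (fun=> 1)); last first.
      by move=> v _; rewrite asboolT.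
    by rewrite sumr_const card_tuple.
  by rewrite sumr_const card_tuple.
rewrite lamp_avg_recr !size_undup_filter_cons.
set s := walk_pos b k; set t := walk_pos b k.+1.
(* The end points differ, so the two fresh lamps constrain distinct sites and contribute independent
   factors. *)
have st : s != t := walk_posS_neq b k.
set E' := fun i => (E i && (i != t)) && (i != s).
have -> : (E s && (s != t)) = E s by rewrite st andbT.
transitivity (lamp_avg F k (fun u v =>
    ((#|F|%:R ^+ E t)^-1 * (#|F|%:R ^+ E s)^-1) *
    `[< forall i, E' i -> lamps b u v k i = 1%g >]%:R : R)); last first.
  by rewrite lamp_avgZ IH !exprD !invfM mulrA.
apply: eq_lamp_avg => u v su sv.
rewrite -!sum_implied big_distrlr exchange_big mulr_suml mulr_sumr.
apply: eq_bigr => y _; rewrite mulr_suml mulr_sumr; apply: eq_bigr => x _.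
have -> : `[< forall i, E i -> lamps b (rcons u x) (rcons v y) k.+1 i = 1%g >] =
    [&& E t ==> (y == 1%g), E s ==> (x == 1%g) &
      `[< forall i, E' i -> lamps b u v k i = 1%g >]].
  rewrite [lamps _ _ _ k.+1]/= -/(walk_pos b k.+1) -/s -/t.
  rewrite !nth_rcons su sv ltnn eqxx.
  apply/asboolP/and3P => [h|[/implyP h1 /implyP h2 /asboolP h3] i Ei].
    split; first by apply/implyP => /h; rewrite eqxx => ->.
      by apply/implyP => /h; rewrite (negPf st) eqxx => ->.
    apply/asboolP => i /andP[/andP[/h + it] si].
    by rewrite (negPf it) (negPf si) lamps_rcons ?su ?sv.
  case: eqVneq => it; first by apply/eqP/h1; rewrite -it.
  case: eqVneq => si; first by apply/eqP/h2; rewrite -si.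
  by rewrite lamps_rcons ?su ?sv // h3 // /E' Ei it si.
rewrite expr2 invfM.
by case: (_ ==> _); case: (_ ==> _); case: `[< _ >] => /=; ring.
Qed.

Definition cover_size (b : seq bool) (k : nat) : nat := size (undup (sites b k)).

(** The case of [lamp_avg_off] in which every site is constrained; lamps never refreshed are still
    trivial and cost nothing. *)
Lemma visit_prob {R : realType} (F : finGroupType) (b : seq bool) (k : nat) :
  lamp_avg F k (fun u v => `[< is_identity b u v k >]%:R) =
  (walk_pos b k == 0)%:R * (#|F|%:R ^+ cover_size b k)^-1 :> R.
Proof.
rewrite /cover_size -[sites b k](filter_predT) -lamp_avg_off -lamp_avgZ.
apply: eq_lamp_avg => u v _ _.
case: eqP => [b0|b0]; last by rewrite mul0r asboolF // => -[/b0].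
rewrite mul1r; congr (nat_of_bool _)%:R; apply: asbool_equiv_eq.
by split=> [[_ h] i _//|h]; split=> // i; exact: h.
Qed.

(** * Size of the visited range and confinement to windows *)

Definition confined (D : pred int) (b : seq bool) (k : nat) : bool :=
  all (fun j => D (walk_pos b j)) (iota 0 k.+1).

Lemma confinedP (D : pred int) (b : seq bool) (k : nat) :
  reflect (forall j, (j <= k)%N -> D (walk_pos b j)) (confined D b k).
Proof.
apply: (iffP allP) => h j; first by move=> jk; apply: h; rewrite mem_iota.
by rewrite mem_iota => /andP[_]; exact: h.
Qed.

Lemma mem_sites (b : seq bool) (k j : nat) :
  (0 < k)%N -> (j <= k)%N -> walk_pos b j \in sites b k.
Proof.
case: k => // k _; elim: k => [|k IH] in j *.
  by case: j => [|[|]] // _; rewrite !inE eqxx ?orbT.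
rewrite leq_eqVlt => /orP[/eqP ->|jk]; first by rewrite /= !inE eqxx.
by rewrite inE orbC inE IH ?orbT.
Qed.

Lemma sitesP (b : seq bool) (k : nat) (x : int) : x \in sites b k ->
  exists2 j, (j <= k)%N & x = walk_pos b j.
Proof.
elim: k => // k IH; rewrite inE => /orP[/eqP ->|]; first by exists k.+1.
rewrite inE => /orP[/eqP ->|/IH[j jk ->]]; first by exists k; rewrite ?leqnSn.
by exists j; rewrite ?leqW.
Qed.

(** Steps of size one cannot jump over a site. *)
Lemma walk_pos_ivt (b : seq bool) (k : nat) (x : int) :
  (0 <= x <= walk_pos b k) || (walk_pos b k <= x <= 0) ->
  exists2 j, (j <= k)%N & x = walk_pos b j.
Proof.
elim: k => [|k IH] /=; first by exists 0%N => //=; lia.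
case E: ((0 <= x <= walk_pos b k) || (walk_pos b k <= x <= 0)).
  by move=> _; have [j jk ->] := IH E; exists j; rewrite ?leqW.
move=> h; exists k.+1 => //=.
by move: h E; case: (nth _ _ _); lia.
Qed.

Definition int_range (c : nat) : seq int := [seq i%:Z - c%:Z | i <- iota 0 c.*2.+1].

Lemma int_range_uniq (c : nat) : uniq (int_range c).
Proof. by rewrite map_inj_uniq ?iota_uniq // => i j; lia. Qed.

Lemma mem_int_range (c : nat) (x : int) : (x \in int_range c) = (`|x| <= c%:Z).
Proof.
apply/mapP/idP => [[i]|xc]; first by rewrite mem_iota => + ->; lia.
by exists (absz (x + c%:Z)); rewrite ?mem_iota; lia.
Qed.

Lemma cover_size_le (b : seq bool) (k c : nat) :
  confined (fun x => `|x| <= c%:Z) b k -> (cover_size b k <= c.*2.+1)%N.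
Proof.
move=> /confinedP h.
rewrite -[c.*2.+1](size_iota 0) -(size_map (fun i => i%:Z - c%:Z)).
apply: uniq_leq_size; first exact: undup_uniq.
move=> x; rewrite mem_undup => /sitesP[j jk ->].
by rewrite -/(int_range c) mem_int_range h.
Qed.

(** All of [-c, c] has been visited. The count 2c + 1 is weakened to 2c, which turns the weight into
    a power of |F|^(-2). *)
Lemma cover_size_ge (b : seq bool) (k c i j : nat) :
  (i <= k)%N -> (j <= k)%N -> (0 < k)%N ->
  walk_pos b i <= - c%:Z -> c%:Z <= walk_pos b j -> (c.*2 <= cover_size b k)%N.
Proof.
move=> ik jk k0 bi bj; apply: (@leq_trans (size (int_range c))).
  by rewrite size_map size_iota.
apply: uniq_leq_size; first exact: int_range_uniq.
move=> x; rewrite mem_int_range mem_undup => xc.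
have [l lk ->] : exists2 l, (l <= k)%N & x = walk_pos b l.
  case: (lerP 0 x) => x0.
    have [|l lj ->] := walk_pos_ivt b j x; first by lia.
    by exists l => //; exact: leq_trans jk.
  have [|l lj ->] := walk_pos_ivt b i x; first by lia.
  by exists l => //; exact: leq_trans ik.
exact: mem_sites.
Qed.

Lemma walk_pos_bound (b : seq bool) (j : nat) : `|walk_pos b j| <= j%:Z.
Proof. by elim: j => //= j; case: (nth _ _ _); lia. Qed.

Lemma geometric_tail {R : realType} (x : R) (K N : nat) : 0 <= x <= 1 / 2 ->
  \sum_(c < N) x ^+ c * (K <= c)%N%:R <= 2 * x ^+ K.
Proof.
move=> x01; have x0 : 0 <= x by lra.
(* The added remainder makes the induction work: it absorbs the next term because x^N + 2 x^(N+1) <=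
   2 x^N for x <= 1/2. *)
suff : \sum_(c < N) x ^+ c * (K <= c)%N%:R + 2 * x ^+ maxn K N <= 2 * x ^+ K.
  by apply: le_trans; rewrite lerDl mulr_ge0 ?exprn_ge0.
elim: N => [|N IH]; first by rewrite big_ord0 maxn0 add0r.
rewrite big_ord_recr /=; apply: le_trans IH; rewrite -addrA lerD2l.
case: (leqP K N) => KN.
  rewrite (maxn_idPr (leqW KN)) mulr1 exprS.
  by have := exprn_ge0 N x0; case/andP: x01 => _; nra.
by rewrite (maxn_idPl KN) mulr0 add0r.
Qed.

(** The single term at [c0] = min(A, B) suffices: by minimality the path reaches both [c0] and
    [- c0], hence covers at least 2 [c0] sites. The bound [k < N] puts [c0] in the range of
    summation. *)
Lemma cover_weight_le {R : realType} (m : nat) (b : seq bool) (k N : nat) :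
  (0 < m)%N -> (k < N)%N ->
  (m%:R ^+ cover_size b k)^-1 <=
  \sum_(c < N) ((m%:R ^+ 2)^-1) ^+ c *
    ((confined (fun z => z <= c%:Z) b k)%:R +
     (confined (fun z => - c%:Z <= z) b k)%:R) :> R.
Proof.
move=> m0 kN; set x := (_ ^+ 2)^-1.
have x0 : 0 <= x by rewrite invr_ge0 exprn_ge0.
pose P c := confined (fun z => z <= c%:Z) b k ||
  confined (fun z => - c%:Z <= z) b k.
have exP : exists c, P c.
  exists k; apply/orP; left; apply/confinedP => j jk.
  by have := walk_pos_bound b j; lia.
case: (ex_minnP exP) => c0 Pc0 min0.
have c0k : (c0 <= k)%N.
  apply: min0; apply/orP; left; apply/confinedP => j jk.
  by have := walk_pos_bound b j; lia.
have c0N : (c0 < N)%N := leq_ltn_trans c0k kN.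
rewrite (bigD1 (Ordinal c0N)) //=; apply: ler_wpDr.
  by apply: sumr_ge0 => c _; rewrite mulr_ge0 ?exprn_ge0 // addr_ge0.
apply: (@le_trans _ _ (x ^+ c0)); last first.
  apply: ler_peMr; first exact: exprn_ge0.
  by rewrite -natrD ler1n; move: Pc0; rewrite /P; do 2 case: (confined _ _ _).
rewrite /x exprVn -exprM lef_pV2 ?posrE ?exprn_gt0 ?ltr0n //.
apply: ler_weXn2l; first by rewrite ler1n.
case: c0 => [|c] in c0k c0N Pc0 min0 *; first by rewrite muln0.
have [] : exists2 j, (j <= k)%N & (c.+1%:Z <= walk_pos b j).
  case/boolP: (confined (fun z => z <= c%:Z) b k) => [h|/confinedP h].
    by have := min0 c; rewrite /P h ltnn => /(_ isT).
  have /existsNP[j /not_implyP[jk bj]] := h.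
  by exists j => //; move/negP: bj; lia.
move=> j jk bj.
have [] : exists2 j, (j <= k)%N & (walk_pos b j <= - c.+1%:Z).
  case/boolP: (confined (fun z => - c%:Z <= z) b k) => [h|/confinedP h].
    by have := min0 c; rewrite /P h ltnn orbT => /(_ isT).
  have /existsNP[i /not_implyP[ik bi]] := h.
  by exists i => //; move/negP: bi; lia.
move=> i ik bi; rewrite mul2n.
by apply: cover_size_ge ik jk _ bi bj; apply: leq_trans c0k.
Qed.

(** Only windows with c at least [c0] = max(A, B) contribute, a geometric tail of ratio at most 1/2.
    The cover has at most 2 [c0] + 1 sites, and the extra site costs the factor [m]. *)
Lemma cover_weight_ge {R : realType} (m : nat) (b : seq bool) (k N : nat) :
  (1 < m)%N ->
  \sum_(c < N) ((m%:R ^+ 2)^-1) ^+ c *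
    (confined (fun z => `|z| <= c%:Z) b k)%:R
  <= 2 * m%:R * (m%:R ^+ cover_size b k)^-1 :> R.
Proof.
move=> m1; set x := (_ ^+ 2)^-1; have m0 : (0 < m)%N by exact: ltnW.
have m2 : (2 : R) <= m%:R by rewrite ler_nat.
have x01 : 0 <= x <= 1 / 2.
  rewrite invr_ge0 exprn_ge0 //= div1r lef_pV2 ?posrE ?exprn_gt0 ?ltr0n //.
  by rewrite expr2; nra.
have x0 : 0 <= x by case/andP: x01.
pose P c := confined (fun z => `|z| <= c%:Z) b k.
case: (pselect (exists c, P c)) => [exP|nP]; last first.
  rewrite big1 => [|c _]; first by rewrite !mulr_ge0 // invr_ge0 exprn_ge0.
  case E: (confined _ _ _); last by rewrite mulr0.
  by case: nP; exists c.
case: (ex_minnP exP) => c0 Pc0 min0.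
apply: (@le_trans _ _ (\sum_(c < N) x ^+ c * (c0 <= c)%N%:R)).
  apply: ler_sum => c _; apply: ler_wpM2l; first exact: exprn_ge0.
  case E: (confined _ _ _) => //.
  by rewrite min0.
apply: (le_trans (geometric_tail x c0 N x01)).
rewrite -mulrA ler_pM2l // /x exprVn -exprM ler_pdivlMr ?exprn_gt0 ?ltr0n //.
rewrite mulrC ler_pdivrMr ?exprn_gt0 ?ltr0n // -exprS.
apply: ler_weXn2l; first by rewrite ler1n.
by rewrite mul2n; exact: cover_size_le.
Qed.

(** * Green function of the killed walk and comparison principles *)

(** Truncated Green function at (0, 0) of the walk killed on leaving [D]. Times run over k < n, so
    visits up to time n correspond to [n.+1]. *)
Definition green {R : realType} (p : R) (D : pred int) (n : nat) : R :=
  \sum_(k < n) path_sum p k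
    (fun b => (walk_pos b k == 0)%:R * (confined D b k)%:R).

(** The transition operator of the walk. *)
Definition mean {R : realType} (p : R) (f : int -> R) (x : int) : R :=
  step_prob p x true * f (x + 1) + step_prob p x false * f (x - 1).

Lemma confined_rcons (D : pred int) (b : seq bool) (c : bool) (k : nat) :
  size b = k ->
  confined D (rcons b c) k.+1 =
  confined D b k && D (walk_pos b k + (if c then 1 else -1)).
Proof.
move=> sb; rewrite -(walk_pos_rconsS b c k sb) /confined.
rewrite -[k.+2]addn1 iotaD all_cat add0n all_seq1; congr (_ && _).
by apply: eq_in_all => j; rewrite mem_iota => jk; rewrite walk_pos_rcons; lia.
Qed.

(** Killing at the new position becomes multiplication by the indicator of [D] under the transition
    operator. *)
Lemma path_sum_mean {R : realType} (p : R) (D : pred int) (f : int -> R)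
    (k : nat) :
  path_sum p k.+1 (fun b => (confined D b k.+1)%:R * f (walk_pos b k.+1)) =
  path_sum p k (fun b =>
    (confined D b k)%:R * mean p (fun y => (D y)%:R * f y) (walk_pos b k)).
Proof.
rewrite path_sum_recr; apply: eq_path_sum => b sb.
rewrite !confined_rcons // !(walk_pos_rconsS b _ k sb) /mean -!mulnb !natrM.
ring.
Qed.

Section Dynkin.
Context {R : realType} (p : R) (D : pred int).
Hypotheses (p01 : 0 <= p <= 1) (D0 : D 0).

Lemma green_recr (k : nat) : green p D k.+1 = green p D k +
  path_sum p k (fun b => (confined D b k)%:R * (walk_pos b k == 0)%:R).
Proof.
rewrite /green big_ord_recr; congr (_ + _).
by apply: eq_path_sum => b _; rewrite mulrC.
Qed.

Lemma path_sum_ge0 (k : nat) (f : seq bool -> R) :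
  (forall b, 0 <= f b) -> 0 <= path_sum p k f.
Proof.
by move=> f0; apply: sumr_ge0 => t _; rewrite mulr_ge0 ?path_prob_ge0.
Qed.

Lemma path_sum_confined0 (f : int -> R) :
  path_sum p 0 (fun b => (confined D b 0)%:R * f (walk_pos b 0)) = f 0.
Proof. by rewrite path_sum0 /confined /= D0 mul1r. Qed.

(** Visits so far plus the mean of [H] on the surviving walk start at [H 0] and never increase;
    nonnegativity of [H] lets the second part be dropped. *)
Lemma green_le_superharmonic (H : int -> R) (n : nat) :
  (forall x, D x -> 0 <= H x) ->
  (forall x, D x -> (x == 0)%:R + mean p (fun y => (D y)%:R * H y) x <= H x) ->
  green p D n <= H 0.
Proof.
move=> H0 sH.
suff : green p D n +
    path_sum p n (fun b => (confined D b n)%:R * H (walk_pos b n)) <= H 0.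
  apply: le_trans; rewrite lerDl path_sum_ge0 // => b.
  case: (confinedP D b n) => [h|_]; last by rewrite mul0r.
  by rewrite mul1r H0 ?h.
elim: n => [|n IH]; first by rewrite path_sum_confined0 /green big_ord0 add0r.
apply: le_trans IH; rewrite green_recr -addrA lerD2l path_sum_mean -path_sumD.
apply: ler_path_sum => // b _.
case: (confinedP D b n) => [h|_]; last by rewrite !mul0r addr0.
by rewrite !mul1r sH ?h.
Qed.

(** [L k x] is a lower bound for the visits from [x] with [k] steps left. Time is reversed: after k
    steps, visits so far plus the mean of [L (n - k)] have not decreased. *)
Lemma green_ge_subsolution (L : nat -> int -> R) (n : nat) :
  (forall x, D x -> L 0%N x <= 0) ->
  (forall k x, D x ->
     L k.+1 x <= (x == 0)%:R + mean p (fun y => (D y)%:R * L k y) x) ->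
  L n 0 <= green p D n.
Proof.
move=> L0 sL.
suff key k : (k <= n)%N -> L n 0 <= green p D k +
    path_sum p k (fun b => (confined D b k)%:R * L (n - k)%N (walk_pos b k)).
  apply: (le_trans (key n (leqnn n))); rewrite gerDl subnn.
  rewrite -oppr_ge0 -mulN1r -path_sumZ; apply: path_sum_ge0 => b.
  case: (confinedP D b n) => [h|_]; last by rewrite mul0r mulr0.
  by rewrite mul1r mulN1r oppr_ge0 L0 ?h.
elim: k => [_|k IH kn].
  by rewrite path_sum_confined0 /green big_ord0 add0r subn0.
apply: (le_trans (IH (ltnW kn))).
rewrite green_recr -addrA lerD2l path_sum_mean -path_sumD.
apply: ler_path_sum => // b _.
case: (confinedP D b k) => [h|_]; last by rewrite !mul0r addr0.
by rewrite !mul1r -(subnSK kn) sL ?h.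
Qed.

Lemma green_le_size (n : nat) : green p D n <= n%:R.
Proof.
rewrite -[n%:R]mulr1n -[n in leRHS]card_ord -sumr_const.
apply: ler_sum => k _; rewrite -[leRHS](path_sum1 p k).
by apply: ler_path_sum => // b _; rewrite -natrM lern1 mulnb leq_b1.
Qed.

Lemma green_mono (k n : nat) : (k <= n)%N -> green p D k <= green p D n.
Proof.
move/subnK <-; elim: (n - k)%N => // d IH; rewrite addSn green_recr.
by apply: (le_trans IH); rewrite lerDl path_sum_ge0 // => b; rewrite mulr_ge0.
Qed.

Lemma green1 : green p D 1 = 1.
Proof.
rewrite green_recr /green big_ord0 add0r.
by rewrite (path_sum_confined0 (fun x => (x == 0)%:R)) eqxx.
Qed.

End Dynkin.

(** * Explicit barriers for the walk drifting towards 0 *)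

Lemma meanN {R : realType} (p : R) (f : int -> R) (x : int) :
  mean p (fun y => f (- y)) x = mean p f (- x).
Proof.
rewrite /mean /step_prob oppr_lt0 oppr_eq0 opprD opprB [- x - 1]addrC.
rewrite [1 - x]addrC [-1 - x]addrC.
by case: ltrgt0P => _; ring.
Qed.

Lemma mean_abs {R : realType} (p : R) (g : nat -> R) (x : int) :
  mean p (fun y => g (absz y)) x =
  if x == 0 then g 1%N else (1 - p) * g (absz x).+1 + p * g (absz x).-1.
Proof.
rewrite /mean /step_prob.
case: ltrgt0P => x0 /=.
- rewrite (_ : absz (x + 1) = (absz x).+1); last by lia.
  by rewrite (_ : absz (x - 1) = (absz x).-1); last by lia.
- rewrite (_ : absz (x + 1) = (absz x).-1); last by lia.
  by rewrite (_ : absz (x - 1) = (absz x).+1); [rewrite addrC|lia].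
- by rewrite x0 /=; field.
Qed.

Section Barriers.
Context {R : realType} (p rho : R).
Hypotheses (p01 : 0 <= p <= 1) (rho1 : 1 < rho) (rhoE : (1 - p) * rho = p).

Let rho0 : 0 <= rho. Proof. exact: ltW (lt_trans ltr01 rho1). Qed.

(** [rho] is the root other than 1 of (1 - p) r^2 - r + p = 0, so rho^|x| is harmonic away from
    0. *)
Lemma mean_exp (n : nat) : (1 - p) * rho ^+ n.+2 + p * rho ^+ n = rho ^+ n.+1.
Proof.
rewrite !exprS [(1 - p) * _]mulrA rhoE -[X in _ + X * _]rhoE; ring.
Qed.

(** Models the expected visits to 0 from [x] before c + 1: zero at c + 1, and constant on the left,
    where the drift leads back to 0. The factor makes the drop from 0 to 1 equal to 2; a right step
    from 0 has probability 1/2, which yields the source term 1. *)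
Definition barrier (c : nat) (x : int) : R :=
  2 / (rho - 1) * (rho ^+ c.+1 - (if 0 <= x then rho ^+ absz x else 1)).

Lemma barrier_ge0 (c : nat) (x : int) : x <= c%:Z -> 0 <= barrier c x.
Proof.
move=> xc; apply: mulr_ge0; first by rewrite divr_ge0 // subr_ge0 ltW.
rewrite subr_ge0; case: ifP => x0; last exact/exprn_ege1/ltW.
by apply: ler_weXn2l; [exact: ltW|lia].
Qed.

Lemma barrier_harmonic (c : nat) (x : int) : x <= c%:Z ->
  (x == 0)%:R + mean p (fun y => (y <= c%:Z)%R%:R * barrier c y) x = barrier c x.
Proof.
move=> xc.
(* From [x <= c] one step leaves the half-line only at c + 1, where the barrier vanishes, so killing
   changes nothing. *)
have cut y : y <= c%:Z + 1 -> (y <= c%:Z)%R%:R * barrier c y = barrier c y.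
  case: (lerP y c%:Z) => [_ _|cy yc]; first by rewrite mul1r.
  rewrite mul0r (_ : y = c.+1%:Z); last by lia.
  by rewrite /barrier /= subrr mulr0.
have r1 : rho - 1 != 0 by rewrite subr_eq0 gt_eqF.
rewrite /mean !cut; [|lia|lia]; rewrite /step_prob /barrier.
case: ltrgt0P => x0 /=.
- rewrite !ifT; [|lia|lia].
  rewrite (_ : absz (x + 1) = (absz x).-1.+2); last by lia.
  rewrite (_ : absz (x - 1) = (absz x).-1); last by lia.
  rewrite [in RHS](_ : absz x = (absz x).-1.+1); last by lia.
  by rewrite -(mean_exp (absz x).-1); ring.
- rewrite [0 <= x - 1]lt_geF; last by lia.
  case: ifP => x1; last by ring.
  by rewrite (_ : absz (x + 1) = 0%N); [rewrite expr0; ring|lia].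
- by rewrite x0 /= expr1 expr0; field.
Qed.

Lemma barrier0_le (c : nat) : barrier c 0 <= 2 / (rho - 1) * rho ^+ c.+1.
Proof.
apply: ler_wpM2l; first by rewrite divr_ge0 // subr_ge0 ltW.
by rewrite gerBl.
Qed.

Lemma green_right_le (c n : nat) :
  green p (fun z => z <= c%:Z) n <= 2 / (rho - 1) * rho ^+ c.+1.
Proof.
apply: le_trans (barrier0_le c).
apply: green_le_superharmonic => // [x xc|x xc]; first exact: barrier_ge0.
by rewrite barrier_harmonic.
Qed.

(** Reflection preserves the walk by [meanN], so the mirrored barrier applies. *)
Lemma green_left_le (c n : nat) :
  green p (fun z => - c%:Z <= z) n <= 2 / (rho - 1) * rho ^+ c.+1.
Proof.
apply: le_trans (barrier0_le c); rewrite -[0]oppr0.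
apply: (green_le_superharmonic p _ p01 _ (fun x => barrier c (- x))).
- by rewrite oppr_le0.
- by move=> x xc; apply: barrier_ge0; lia.
move=> x xc; pose f y := (y <= c%:Z)%R%:R * barrier c y.
rewrite -[leRHS]barrier_harmonic; last by lia.
rewrite -/f -(meanN p f x) oppr_eq0 lerD2l le_eqVlt; apply/orP; left; apply/eqP.
by congr (mean p _ x); apply/funext => y; rewrite /f lerNl.
Qed.

(* The subsolution combines three facts on the walk killed outside [-c, c]:
   [rho ^ |S|] gains at most [rho - 1] per step, so the walk survives [n] steps
   except on an event of probability at most [(1 + (rho - 1) n) / rho ^ (c + 1)];
   and [|S|] loses [2 p - 1] per step off [0] and gains [1] at [0], so time alive
   is paid for by visits to [0]. *)
Lemma green_centered_ge (c n : nat) : 1 / 2 < p ->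
  (2 * p - 1) / (2 * p) * n%:R * (1 - (1 + (rho - 1) * n%:R) / rho ^+ c.+1) <=
  green p (fun z => `|z| <= c%:Z) n.
Proof.
(* [e] balances the two gains: 1 - (1 - e) = e at 0, and (1 - e)(2p - 1) = e from the drift off
   0. *)
move=> p2; set e := (2 * p - 1) / (2 * p); set t := (rho ^+ c.+1)^-1.
have rc : 0 < rho ^+ c.+1 by rewrite exprn_gt0 // (lt_trans ltr01).
have t0 : 0 <= t by rewrite invr_ge0 ltW.
have e0 : 0 <= e by rewrite divr_ge0; lra.
have p0 : p != 0 by lra.
have eE : (1 - e) * (2 * p - 1) = e by rewrite /e; field.
have e1 : e <= 1 by rewrite ler_pdivrMr; lra.
(* [Phi k a] bounds from below the probability of surviving [k] steps from distance [a], by Markov's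
   inequality for rho^|S| at the exit level. *)
pose Phi (k a : nat) : R := 1 - (rho ^+ a + (rho - 1) * k%:R) * t.
pose g (k a : nat) : R := e * k%:R * Phi k a - (1 - e) * a%:R.
have Phi1 k a : Phi k a <= 1.
  rewrite gerBl mulr_ge0 // addr_ge0 ?exprn_ge0 // mulr_ge0 //.
  by rewrite subr_ge0 ltW.
have -> : e * n%:R * (1 - (1 + (rho - 1) * n%:R) * t) = g n (absz 0).
  by rewrite /g /Phi expr0 mulr0 subr0.
apply: (green_ge_subsolution p _ p01 _ (fun k x => g k (absz x))) => //.
  by move=> x _; rewrite /g mulr0 mul0r sub0r oppr_le0 mulr_ge0 // subr_ge0.
move=> k x xc.
(* Outside the window [Phi], hence [g], is nonpositive, so killing can only raise the mean. *)
have cut y : g k (absz y) <= (`|y| <= c%:Z)%R%:R * g k (absz y).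
  case: (lerP `|y| c%:Z) => [_|cy]; first by rewrite mul1r.
  rewrite mul0r /g subr_le0; apply: (@le_trans _ _ 0); last first.
    by rewrite mulr_ge0 // subr_ge0.
  apply: mulr_ge0_le0; first exact: mulr_ge0.
  rewrite /Phi subr_le0 mulrDl.
  apply: ler_wpDr; first by rewrite !mulr_ge0 // subr_ge0 ltW.
  rewrite /t ler_pdivlMr // mul1r; apply: ler_weXn2l; first exact: ltW.
  by clear -cy; lia.
apply: (@le_trans _ _ ((x == 0)%:R + mean p (fun y => g k (absz y)) x)).
  rewrite mean_abs; case: eqVneq => [->|x0] /=.
    rewrite /g /Phi -[k.+1%:R]natr1 expr1 expr0 mulr0 subr0.
    have -> : rho + (rho - 1) * k%:R = 1 + (rho - 1) * (k%:R + 1) by ring.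
    have := Phi1 k.+1 0%N; rewrite /Phi expr0 -[k.+1%:R]natr1.
    set f := 1 - _ * t => f1.
    have : e * f <= e by rewrite -[leRHS]mulr1 ler_wpM2l.
    by rewrite mulr1 !mulrDr !mulrDl mulr1; lra.
  have [a ->] : exists a, absz x = a.+1 by clear -x0; exists (absz x).-1; lia.
  rewrite add0r /=.
  have avg : (1 - p) * Phi k a.+2 + p * Phi k a = Phi k a.+1.
    by rewrite /Phi -(mean_exp a); ring.
  have -> : (1 - p) * g k a.+2 + p * g k a =
      e * k%:R * Phi k a.+1 - (1 - e) * a.+1%:R + e.
    rewrite -avg -{3}eE /g -[a.+2%:R]natr1 -[a.+1%:R]natr1; ring.
  have -> : g k.+1 a.+1 = e * k%:R * Phi k.+1 a.+1 - (1 - e) * a.+1%:R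
      + e * Phi k.+1 a.+1.
    rewrite /g -[k.+1%:R]natr1; ring.
  apply: lerD; last by rewrite -[leRHS]mulr1 ler_wpM2l.
  rewrite lerD2r; apply: ler_wpM2l; first exact: mulr_ge0.
  rewrite /Phi lerD2l lerN2; apply: ler_wpM2r => //.
  rewrite lerD2l; apply: ler_wpM2l; first by rewrite subr_ge0 ltW.
  by rewrite ler_nat.
rewrite lerD2l /mean; apply: lerD; apply: ler_wpM2l => //;
  exact: step_prob_ge0.
Qed.

End Barriers.

(** * Expected visits between two geometric sums *)

Section Visits.
Context {R : realType} (p : R) (F : finGroupType).
Hypothesis (p01 : 0 <= p <= 1) (F1 : (1 < #|F|)%N).
Let x : R := (#|F|%:R ^+ 2)^-1.

Let x0 : 0 <= x. Proof. by rewrite invr_ge0 exprn_ge0. Qed.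

Lemma expected_visits_cover (n : nat) :
  expected_visits p F n = \sum_(k < n.+1) path_sum p k
    (fun b => (walk_pos b k == 0)%:R * (#|F|%:R ^+ cover_size b k)^-1).
Proof.
rewrite expected_visitsE; apply: eq_bigr => k _; apply: eq_path_sum => b _.
exact: visit_prob.
Qed.

Lemma expected_visits_le_green (n N : nat) : (n < N)%N ->
  expected_visits p F n <=
  \sum_(c < N) x ^+ c * (green p (fun z => z <= c%:Z) n.+1 +
                         green p (fun z => - c%:Z <= z) n.+1).
Proof.
move=> nN; rewrite expected_visits_cover /green.
under [leRHS]eq_bigr => c _ do rewrite -big_split mulr_sumr.
rewrite exchange_big; apply: ler_sum => k _.
under [leRHS]eq_bigr => c _ do rewrite /= -path_sumD -path_sumZ.
rewrite -(path_sum_sum p k N (fun c b => x ^+ c *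
  ((walk_pos b k == 0)%:R * (confined (fun z => z <= c%:Z) b k)%:R +
   (walk_pos b k == 0)%:R * (confined (fun z => - c%:Z <= z) b k)%:R))).
apply: ler_path_sum => // b _.
under [leRHS]eq_bigr => c _ do rewrite -mulrDr mulrCA.
rewrite -mulr_sumr; apply: ler_wpM2l; first exact: ler0n.
apply: cover_weight_le; first exact: ltnW.
by apply: leq_trans nN; rewrite ltn_ord.
Qed.

Lemma green_le_expected_visits (n N : nat) :
  \sum_(c < N) x ^+ c * green p (fun z => `|z| <= c%:Z) n.+1 <=
  2 * #|F|%:R * expected_visits p F n.
Proof.
rewrite expected_visits_cover /green mulr_sumr.
under [leLHS]eq_bigr => c _ do rewrite mulr_sumr.
rewrite exchange_big; apply: ler_sum => k _.
rewrite -path_sumZ.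
under [leLHS]eq_bigr => c _ do rewrite -path_sumZ.
rewrite -(path_sum_sum p k N (fun c b => x ^+ c *
  ((walk_pos b k == 0)%:R * (confined (fun z => `|z| <= c%:Z) b k)%:R))).
apply: ler_path_sum => // b _.
under [leLHS]eq_bigr => c _ do rewrite mulrCA.
rewrite -mulr_sumr mulrCA; apply: ler_wpM2l; first exact: ler0n.
exact: cover_weight_ge.
Qed.

Context (rho : R).
Hypotheses (rho1 : 1 < rho) (rhoE : (1 - p) * rho = p).

(** For c < K the barriers bound the Green functions by multiples of rho^c; for c >= K they are at
    most n + 1 <= rho^K, and the tail of powers of [x] sums to at most 2 x^K. *)
Lemma expected_visits_le_geometric (n K : nat) : n.+1%:R <= rho ^+ K ->
  expected_visits p F n <=
  (4 * rho / (rho - 1) + 4) * \sum_(c < K.+1) (rho * x) ^+ c.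
Proof.
move=> nK; have r0 : 0 <= rho by rewrite ltW // (lt_trans ltr01).
have r10 : 0 < rho - 1 by rewrite subr_gt0.
apply: (le_trans (expected_visits_le_green n (K + n.+1) (leq_addl _ _))).
have y0 : 0 <= rho * x by rewrite mulr_ge0.
have k0 : 0 <= 4 * rho / (rho - 1) by rewrite divr_ge0 ?mulr_ge0 // ltW.
rewrite big_split_ord /= mulrDl; apply: lerD.
  rewrite big_ord_recr mulrDr /=; apply: ler_wpDr.
    by rewrite mulr_ge0 ?exprn_ge0.
  rewrite mulr_sumr; apply: ler_sum => c _.
  apply: (@le_trans _ _ (x ^+ c * (2 * (2 / (rho - 1) * rho ^+ c.+1)))).
    apply: ler_wpM2l; first exact: exprn_ge0.
    rewrite mulrDl mul1r.
    by apply: lerD; [exact: green_right_le|exact: green_left_le].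
  rewrite exprMn exprS le_eqVlt; apply/orP; left; apply/eqP; ring.
apply: (@le_trans _ _ (2 * n.+1%:R * x ^+ K * \sum_(i < n.+1) x ^+ i * (0 <= i)%N%:R)).
  rewrite mulr_sumr; apply: ler_sum => i _.
  rewrite exprD leq0n mulr1 -[leRHS]mulrA mulrC ler_wpM2r ?mulr_ge0 ?exprn_ge0 //.
  rewrite mulrDl mul1r; apply: lerD; apply: green_le_size => //=; lia.
have x12 : 0 <= x <= 1 / 2.
  rewrite x0 /= div1r lef_pV2 ?posrE ?exprn_gt0 ?ltr0n ?(ltnW F1) //.
  have : (2 : R) <= #|F|%:R by rewrite ler_nat.
  by rewrite expr2; nra.
apply: (@le_trans _ _ (4 * (rho * x) ^+ K)).
  have := geometric_tail x 0 n.+1 x12; rewrite expr0 mulr1 => h.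
  apply: (le_trans (ler_wpM2l _ h)).
    by rewrite !mulr_ge0 ?exprn_ge0.
  have := ler_wpM2r (exprn_ge0 K x0) nK; rewrite exprMn; lra.
rewrite ler_wpM2l // big_ord_recr /= lerDr.
by apply: sumr_ge0 => i _; rewrite exprn_ge0.
Qed.

Let gap : R := (2 * p - 1) / (2 * p) * (1 - rho^-1) ^+ 2 / rho.

(** By monotonicity the horizon can be shortened to [k], the integer part of rho^c, where survival
    is still likely enough. In [gap], one factor 1 - 1/rho pays for this rounding and (1 -
    1/rho)/rho bounds the survival factor. *)
Lemma green_centered_ge_exp (n c : nat) : 1 / 2 < p -> rho ^+ c <= n.+1%:R ->
  gap * rho ^+ c <= green p (fun z => `|z| <= c%:Z) n.+1.
Proof.
move=> p2 cn; have r0 : 0 < rho by rewrite (lt_trans ltr01).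
set e := (2 * p - 1) / (2 * p); set q := 1 - rho^-1.
have e0 : 0 <= e by rewrite divr_ge0; lra.
have e1 : e <= 1 by rewrite ler_pdivrMr; lra.
have ri0 : 0 < rho^-1 by rewrite invr_gt0.
have ri1 : rho^-1 <= 1 by rewrite invf_le1 // ltW.
have q0 : 0 <= q by rewrite subr_ge0.
have q1 : q <= 1 by rewrite gerBl ltW.
have gapE : gap = e * q * (q * rho^-1) by rewrite /gap /e /q; ring.
(* For c = 0 the visit at time 0 already gives 1; the general argument relies on rho <= rho^c. *)
case: c => [|c] in cn *.
  apply: (@le_trans _ _ (green p (fun z => `|z| <= 0%:Z) 1)); last first.
    exact: green_mono.
  rewrite green1 // expr0 mulr1 gapE.
  have ri0' := ltW ri0.
  by apply: mulr_ile1; (apply: mulr_ge0 || apply: mulr_ile1).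
set r := rho ^+ c.+1; have rr : rho <= r by rewrite ler_eXnr // ltW.
have rpos : 0 < r by apply: lt_le_trans rr.
set k := Num.truncn r.
have /andP[kr rk] : k%:R <= r < k.+1%:R by rewrite truncn_itv // ltW.
have kn : (k <= n.+1)%N by rewrite -(ler_nat R); apply: le_trans cn.
apply: (@le_trans _ _ (green p (fun z => `|z| <= c.+1%:Z) k)); last first.
  exact: green_mono.
apply: le_trans (green_centered_ge p rho p01 rho1 rhoE c.+1 k p2).
rewrite gapE -/e (_ : rho ^+ c.+2 = rho * r); last by rewrite exprS.
have -> : e * q * (q * rho^-1) * r = e * (q * r) * (q * rho^-1) by ring.
have rV : r^-1 <= rho^-1 by rewrite lef_pV2.
have rVr : r^-1 * r = 1 by rewrite mulVf // gt_eqF.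
have rrho : rho^-1 * rho = 1 by rewrite mulVf // gt_eqF.
apply: ler_pM.
- by apply: mulr_ge0 => //; apply: mulr_ge0 => //; exact: ltW.
- by apply: mulr_ge0 => //; exact: ltW.
  apply: ler_wpM2l => //; rewrite /q mulrBl mul1r.
  have : 1 <= rho^-1 * r by rewrite -[leLHS]rrho ler_pM2l.
  by move: rk; rewrite -natr1; lra.
rewrite invfM.
have : (1 + (rho - 1) * k%:R) * (rho^-1 * r^-1) <=
    (1 + (rho - 1) * r) * (rho^-1 * r^-1).
  rewrite ler_wpM2r ?mulr_ge0 ?invr_ge0 ?(ltW rpos) ?(ltW r0) // lerD2l.
  by rewrite ler_wpM2l // subr_ge0 ltW.
have -> : (1 + (rho - 1) * r) * (rho^-1 * r^-1) =
    rho^-1 * r^-1 + (rho^-1 * rho - rho^-1) * (r^-1 * r) by ring.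
rewrite rVr rrho => h.
have : rho^-1 * r^-1 <= rho^-1 * rho^-1 by rewrite ler_pM2l.
by rewrite /q mulrBl; lra.
Qed.

Lemma geometric_le_expected_visits (n K : nat) : 1 / 2 < p ->
  (forall c, (c < K)%N -> rho ^+ c <= n.+1%:R) ->
  gap * \sum_(c < K) (rho * x) ^+ c <= 2 * #|F|%:R * expected_visits p F n.
Proof.
move=> p2 Kn; apply: le_trans (green_le_expected_visits n K).
rewrite mulr_sumr; apply: ler_sum => c _.
rewrite exprMn mulrA mulrC ler_wpM2l ?exprn_ge0 //.
exact: green_centered_ge_exp (Kn c (ltn_ord c)).
Qed.

End Visits.

(** * Logarithmic scale and growth of the geometric sum *)

(** [K.+1] is the least exponent at which the powers of [rho] reach n + 1. It exists by Bernoulli's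
    inequality and is positive because n + 1 > 1. *)
Lemma log_scale {R : realType} (rho : R) (n : nat) : 1 < rho -> (0 < n)%N ->
  exists K : nat, [/\ n.+1%:R <= rho ^+ K.+1, rho ^+ K <= n.+1%:R &
    forall c, (c < K.+1)%N -> rho ^+ c <= n.+1%:R].
Proof.
move=> r1 n0; have h0 : 0 < rho - 1 by rewrite subr_gt0.
have bern k : k%:R * (rho - 1) <= rho ^+ k.
  have r0 : 0 <= rho by rewrite ltW // (lt_trans ltr01).
  suff : 1 + k%:R * (rho - 1) <= rho ^+ k by lra.
  elim: k => [|k IH]; first by rewrite mul0r addr0.
  rewrite exprS; apply: le_trans (ler_wpM2l r0 IH).
  have : 0 <= k%:R * (rho - 1) ^+ 2 :> R by rewrite mulr_ge0 ?exprn_ge0 // ltW.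
  by rewrite -[k.+1%:R]natr1 expr2; lra.
have exK : exists K, n.+1%:R <= rho ^+ K.
  pose t := n.+1%:R / (rho - 1); exists (Num.truncn t).+1.
  apply: le_trans (bern _); rewrite -ler_pdivrMr //.
  by have := truncnS_gt t; exact: ltW.
case: (ex_minnP exK) => K nK minK.
have below c : (c < K)%N -> rho ^+ c <= n.+1%:R.
  by move=> cK; rewrite leNgt; apply/negP => /ltW /minK; rewrite leqNgt cK.
case: K => [|K] in nK minK below *.
  by move: nK; rewrite expr0 lern1; case: n n0 {minK below exK}.
by exists K; split=> //; exact: below.
Qed.

(** The upper bound on the visits uses one more term than the lower bound; this prices the extra
    term. *)
Lemma geometric_recl_le {R : realType} (y : R) (K : nat) : 0 <= y ->
  \sum_(c < K.+2) y ^+ c <= (1 + y) * \sum_(c < K.+1) y ^+ c.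
Proof.
move=> y0; rewrite big_ord_recl expr0 mulrDl mul1r; apply: lerD.
  rewrite big_ord_recl expr0 lerDl; apply: sumr_ge0 => i _.
  exact: exprn_ge0.
by rewrite mulr_sumr; apply: ler_sum => i _; rewrite exprS.
Qed.

Lemma geometric_ge1 {R : realType} (y : R) (K : nat) : 0 <= y ->
  1 <= \sum_(c < K.+1) y ^+ c.
Proof.
move=> y0; rewrite big_ord_recl expr0 lerDl.
by apply: sumr_ge0 => i _; exact: exprn_ge0.
Qed.

Lemma growth_ge0 {R : realType} (p : R) (m n : nat) :
  (0 < n)%N -> 0 <= growth p m n.
Proof.
move=> n0; rewrite /growth; case: ifP => // _; case: ifP => _.
  by rewrite ln_ge0 // ler1n.
exact: powR_ge0.
Qed.

Lemma geometric_growth {R : realType} (p : R) (m : nat) :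
  1 / 2 < p -> p < 1 -> (1 < m)%N ->
  let rho := p / (1 - p) in let y := rho * (m%:R ^+ 2)^-1 in
  exists a b : R, [/\ 0 < a, 0 < b & forall n K : nat, (1 < n)%N ->
    n.+1%:R <= rho ^+ K.+1 -> rho ^+ K <= n.+1%:R ->
    a * growth p m n <= \sum_(c < K.+1) y ^+ c <= b * growth p m n].
Proof.
move=> p2 p1 m1 rho y.
have q0 : 0 < 1 - p by lra.
have r1 : 1 < rho by rewrite /rho ltr_pdivlMr // mul1r; lra.
have r0 : 0 < rho by rewrite (lt_trans ltr01).
have m0 : (0 : R) < m%:R by rewrite ltr0n ltnW.
set M : R := m%:R ^+ 2; have M0 : 0 < M by rewrite exprn_gt0.
have y0 : 0 < y by rewrite mulr_gt0 // invr_gt0.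
have lr0 : 0 < ln rho by rewrite ln_gt0.
(* Clearing denominators, p < M / (M + 1) reads p < (1 - p) M, that is rho < M. *)
have lt_thr : (p < M / (M + 1)) = (y < 1).
  rewrite /y ltr_pdivrMr // mul1r /rho ltr_pdivrMr // ltr_pdivlMr ?addr_gt0 //.
  by rewrite -/M; apply/idP/idP; lra.
have eq_thr : (p == M / (M + 1)) = (y == 1).
  have M1 : M + 1 != 0 by rewrite gt_eqF // addr_gt0.
  have M00 : M != 0 by rewrite gt_eqF.
  have q00 : 1 - p != 0 by rewrite gt_eqF.
  apply/eqP/eqP => [pE|].
    rewrite /y /rho -/M; have -> : 1 - p = (M + 1)^-1 by rewrite pE; field.
    by rewrite pE; field; rewrite M00.
  rewrite /y /rho -/M => yE; apply: (mulIf M1); rewrite divfK //.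
  have pM : p = (1 - p) * M.
    by rewrite -[LHS](divfK q00) -[p / _](divfK M00) yE mul1r mulrC.
  by rewrite mulrDr mulr1 {2}pM; ring.
rewrite /growth -/M lt_thr eq_thr; case: ltrgtP => y1.
- exists 1, (1 - y)^-1; rewrite invr_gt0 subr_gt0; split=> // n K _ _ _.
  rewrite mulr1 mulr1 geometric_ge1 ?(ltW y0) //=.
  rewrite -[leRHS]mul1r ler_pdivlMr ?subr_gt0 // mulrC.
  rewrite -opprB mulNr -subrX1 opprB gerBl exprn_ge0 //; exact: ltW.
(* Since m^2 = rho^(2 alpha), the ratio [y] is rho^beta, which converts powers of [y] into powers of
   n. *)
- pose beta := 1 - 2 * alpha p m.
  have yE : y = rho `^ beta.
    rewrite /powR gt_eqF // /beta /alpha -/rho mulrBl mul1r.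
    rewrite -mulrA divfK ?gt_eqF // expRB lnK ?posrE // /y /M.
    by rewrite mulr_natl mulr2n expRD lnK ?posrE // expr2.
  have beta0 : 0 < beta.
    by have := ln_gt0 y1; rewrite yE ln_powR pmulr_lgt0.
  have yX k : y ^+ k = (rho ^+ k) `^ beta.
    rewrite -powR_mulrn ?(ltW y0) // yE -powRrM mulrC powRrM.
    by rewrite powR_mulrn // ltW.
  have yi0 : 0 < y^-1 by rewrite invr_gt0.
  (* The last power dominates. From below, n <= rho^(K+1) gives n^beta <= y y^K; from above, rho^K
     <= n + 1 <= 2n brings in 2^beta. *)
  exists y^-1, (y * 2 `^ beta / (y - 1)); split=> //.
    by rewrite divr_gt0 ?subr_gt0 // mulr_gt0 // powR_gt0.
  move=> n K n1 nK Kn; rewrite -/beta.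
  have n0 : (0 : R) <= n%:R by exact: ler0n.
  apply/andP; split.
    apply: (@le_trans _ _ (y ^+ K)); last first.
      rewrite big_ord_recr /= lerDr; apply: sumr_ge0 => i _.
      by rewrite exprn_ge0 // ltW.
    rewrite mulrC ler_pdivrMr // -exprSr yX.
    apply: ge0_ler_powR; rewrite ?nnegrE ?(ltW beta0) ?exprn_ge0 ?(ltW r0) //.
    by apply: le_trans nK; rewrite ler_nat.
  rewrite mulrAC ler_pdivlMr ?subr_gt0 // mulrC -subrX1.
  apply: (@le_trans _ _ (y ^+ K.+1)); first by rewrite gerBl.
  rewrite exprS -[leRHS]mulrA; apply: ler_wpM2l; first exact: ltW.
  rewrite yX -powRM //.
  apply: ge0_ler_powR; rewrite ?nnegrE ?(ltW beta0) ?exprn_ge0 ?(ltW r0) //.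
  by apply: (le_trans Kn); rewrite -natrM ler_nat; clear -n1; lia.
- have l2 : (0 : R) < ln 2 by rewrite ln_gt0 // ltr1n.
  (* The sum is K + 1. Above, rho^K <= n + 1 <= n^2 bounds K, and n >= 2 bounds the remaining 1 by
     ln n / ln 2. *)
  exists (ln rho)^-1, (2 / ln rho + (ln 2)^-1); split.
  + by rewrite invr_gt0.
  + by rewrite addr_gt0 ?invr_gt0 // divr_gt0.
  move=> n K n1 nK Kn; rewrite y1.
  under eq_bigr do rewrite expr1n.
  rewrite sumr_const card_ord.
  have n0 : (0 : R) < n%:R by rewrite ltr0n ltnW.
  apply/andP; split.
    rewrite mulrC ler_pdivrMr // mulr_natl -lnXn //.
    rewrite ler_ln ?posrE ?exprn_gt0 //.
    by apply: le_trans nK; rewrite ler_nat.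
  rewrite mulrDl -[1 *+ K.+1]natr1; apply: lerD.
    rewrite mulrAC ler_pdivlMr // mulr_natl -lnXn // mulr_natl -lnXn //.
    rewrite ler_ln ?posrE ?exprn_gt0 //; apply: (le_trans Kn).
    by rewrite -natrX ler_nat; clear -n1; nia.
  rewrite mulrC ler_pdivlMr // mul1r ler_ln ?posrE //.
  by rewrite ler_nat.
Qed.

(** * Assembly of the constants *)

Theorem theorem1p2 (R : realType) (p : R) (m : nat) :
  1 / 2 < p -> p < 1 -> (1 < m)%N ->
  exists c C : R, 0 < c /\ c <= C /\
    forall (F : finGroupType), #|F| = m ->
    forall n : nat, (2 <= n)%N ->
      c * growth p m n <= expected_visits p F n /\
      expected_visits p F n <= C * growth p m n.
Proof.
move=> p2 p1 m1; have [a [b [a0 b0]]] := geometric_growth p m p2 p1 m1.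
set rho := p / (1 - p); set y := rho * _ => bounds.
have p01 : 0 <= p <= 1 by lra.
have q0 : 0 < 1 - p by lra.
have r1 : 1 < rho by rewrite /rho ltr_pdivlMr // mul1r; lra.
have rE : (1 - p) * rho = p by rewrite mulrC divfK // gt_eqF.
have m0 : (0 : R) < m%:R by rewrite ltr0n ltnW.
have r0 : 0 < rho by rewrite (lt_trans ltr01).
have y0 : 0 <= y by rewrite mulr_ge0 ?invr_ge0 ?exprn_ge0 // ltW.
set g := (2 * p - 1) / (2 * p) * (1 - rho^-1) ^+ 2 / rho.
have g0 : 0 < g.
  apply: divr_gt0 => //; apply: mulr_gt0; first by apply: divr_gt0; lra.
  by apply: exprn_gt0; rewrite subr_gt0 invf_lt1.
pose c := g * a / (2 * m%:R).
pose C := (4 * rho / (rho - 1) + 4) * (1 + y) * b.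
have c0 : 0 < c by apply: divr_gt0; exact: mulr_gt0.
(* The maximum secures the order of the two constants; enlarging [C] is harmless as [growth] is
   nonnegative. *)
exists c, (Num.max c C); split=> //; split; first by rewrite le_max lexx.
move=> F Fm n n2; have F1 : (1 < #|F|)%N by rewrite Fm.
have [K [nK Kn below]] := log_scale rho n r1 (ltnW n2).
have /andP[lo hi] := bounds n K n2 nK Kn.
split.
  have := geometric_le_expected_visits p F p01 F1 rho r1 rE n K.+1 p2 below.
  rewrite Fm -/g -/y => h.
  rewrite -(ler_pM2l (_ : 0 < 2 * m%:R)) ?mulr_gt0 //; apply: le_trans h.
  have -> : 2 * m%:R * (c * growth p m n) = g * (a * growth p m n).
    by rewrite /c; field; rewrite gt_eqF.
  by rewrite ler_pM2l.
apply: (@le_trans _ _ (C * growth p m n)); last first.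
  by rewrite ler_wpM2r ?growth_ge0 ?(ltnW n2) // le_max lexx orbT.
have k0 : 0 <= 4 * rho / (rho - 1) + 4.
  apply: addr_ge0 => //; apply: divr_ge0; last by rewrite subr_ge0 ltW.
  by apply: mulr_ge0 => //; exact: ltW.
apply: (le_trans (expected_visits_le_geometric p F p01 F1 rho r1 rE n K.+1 nK)).
rewrite Fm -/y.
have -> : C * growth p m n =
    (4 * rho / (rho - 1) + 4) * ((1 + y) * (b * growth p m n)).
  by rewrite /C; ring.
apply: ler_wpM2l => //.
apply: (le_trans (geometric_recl_le y K y0)).
by apply: ler_wpM2l => //; rewrite addr_ge0.
Qed.
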